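(* Let $a<b$ be real numbers, let $g:\mathbb{R}\to\mathbb{R}$ be non-decreasing and left continuous, and let $S\subset \operatorname{BUC}_g([a,b],\mathbb{F})$. Then $S$ is precompact (relatively compact, with respect to the supremum norm) if and only if 1. $S(t)=\{f(t):f\in S\}$ is bounded for all $t\in[a,b]$; and 2. $S$ is uniformly $g$-equicontinuous.
   Context: $\mathbb{F}$ is $\mathbb{R}$ or $\mathbb{C}$. A function $f:[a,b]\to\mathbb{F}$ is uniformly $g$-continuous if for every $\varepsilon>0$ there is $\delta>0$ such that $|f(t)-f(s)|<\varepsilon$ for all $s,t\in[a,b]$ with $|g(t)-g(s)|<\delta$. $\operatorname{BUC}_g([a,b],\mathbb{F})$ is the Banach space of bounded uniformly $g$-continuous functions $[a,b]\to\mathbb{F}$ with the supremum norm. A set $S$ of such functions is uniformly $g$-equicontinuous if for every $\varepsilon>0$ there is $\delta>0$ such that $|f(t)-f(s)|<\varepsilon$ for every $f\in S$ and all $s,t\in[a,b]$ with $|g(t)-g(s)|<\delta$. *)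

(* Defs.v *)
From HB Require Import structures.
From mathcomp Require Import all_boot all_order all_algebra complex.
From mathcomp Require Import ring.
From mathcomp Require Import all_classical all_reals all_analysis.

Set Implicit Arguments.
Unset Strict Implicit.
Unset Printing Implicit Defensive.

Import Order.TTheory GRing.Theory Num.Theory.
Import numFieldNormedType.Exports.

Local Open Scope classical_set_scope.
Local Open Scope ring_scope.

Variant field_kind := RealField | ComplexField.

Definition RorC (R : realType) (F : field_kind) : numFieldType :=
  match F with RealField => R | ComplexField => R[i] end.

(* In a numFieldType the norm takes its values in the field itself, so over
   R[i] the modulus `|z| is a complex number with zero imaginary part.
   [modulus] is the same quantity as an element of R, and [of_real] is the
   canonical embedding of R. *)
Definition of_real {R : realType} (F : field_kind) : R -> RorC R F :=
  match F with
  | RealField => fun x => x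
  | ComplexField => fun x => Complex x 0
  end.

Definition modulus {R : realType} (F : field_kind) : RorC R F -> R :=
  match F with
  | RealField => fun x => `|x|
  | ComplexField => fun z => complex.Re `|z|
  end.
Arguments modulus {R F} z.

Section complex_complete.
Context {R : realType}.
Let C : numFieldType := R[i].
Implicit Types z w : C.

Let normc_ge_Im z : `|complex.Im z|%:C%C <= `|z|.
Proof.
case: z => p q; rewrite normc_def /= lecR -sqrtr_sqr.
by rewrite ler_sqrt ?addr_ge0 ?sqr_ge0// lerDr sqr_ge0.
Qed.

Let normc_le_ReIm z : `|z| <= (`|complex.Re z| + `|complex.Im z|)%:C%C.
Proof.
case: z => p q; rewrite normc_def /= lecR -[leRHS]ger0_norm ?addr_ge0//.
rewrite -sqrtr_sqr ler_sqrt ?sqr_ge0//.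
rewrite sqrrD !real_normK ?num_real// -addrA lerD2l.
by rewrite lerDr mulrn_wge0// mulr_ge0.
Qed.

Lemma complex_complete (H : set_system C) :
  ProperFilter H -> cauchy H -> cvg H.
Proof.
move=> FH cH.
have cpart (p : C -> R) : (forall z w, (`|p z - p w|%:C <= `|z - w|)%C) ->
    cvg (p @ H).
  move=> pB; apply: (@R_complete R); apply/cauchy_ballP => e e0.
  have e0C : (0 : C) < e%:C%C by rewrite ltcR.
  have /cauchy_ballP /(_ _ e0C) [[A B] /= [HA HB] AB] := cH.
  exists (p @` A, p @` B) => /=.
    split; rewrite nbhs_simpl /=.
      by apply: filterS HA => z Az; exists z.
    by apply: filterS HB => z Bz; exists z.
  move=> [_ _] /= [[z Az <-] [w Bw <-]].
  have := AB (z, w) (conj Az Bw).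
  rewrite -!ball_normE /= => zw.
  by rewrite -ltcR (le_lt_trans (pB z w)).
have cRe : cvg ((@complex.Re R : C -> R) @ H).
  by apply: cpart => z w; rewrite -raddfB normc_ge_Re.
have cIm : cvg ((@complex.Im R : C -> R) @ H).
  by apply: cpart => z w; rewrite -raddfB normc_ge_Im.
apply/cvg_ex.
exists (Complex (lim ((@complex.Re R : C -> R) @ H)) (lim ((@complex.Im R : C -> R) @ H))).
apply/cvgrPdist_lt => e e0.
have [d de] : exists d : R, e = d%:C%C.
  by exists (complex.Re e); rewrite RRe_real// gtr0_real.
have d20 : 0 < d / 2 by rewrite divr_gt0// -ltcR -de.
near=> z.
have hRe : `|lim ((@complex.Re R : C -> R) @ H) - complex.Re z| < d / 2.
  by near: z; move/cvgrPdist_lt : cRe; exact.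
have hIm : `|lim ((@complex.Im R : C -> R) @ H) - complex.Im z| < d / 2.
  by near: z; move/cvgrPdist_lt : cIm; exact.
apply: (le_lt_trans (normc_le_ReIm _)); rewrite de ltcR.
by case: (z) hRe hIm => p q /= hRe hIm; rewrite (splitr d) ltrD.
Unshelve. all: by end_near. Qed.

End complex_complete.

Section RorC_theory.
Context {R : realType} {F : field_kind}.
Implicit Types (x y : R) (z w : RorC R F).

Lemma of_real_modulus z : of_real F (modulus z) = `|z|.
Proof. by case: F z => //= -[p q]; rewrite normc_def. Qed.

Lemma of_real_le x y : (of_real F x <= of_real F y) = (x <= y).
Proof. by case: F => //=; exact: lecR. Qed.

Lemma of_real_lt x y : (of_real F x < of_real F y) = (x < y).
Proof. by case: F => //=; exact: ltcR. Qed.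

Lemma of_real0 : of_real F 0 = 0 :> RorC R F.
Proof. by case: F. Qed.

Lemma of_realD x y : of_real F (x + y) = of_real F x + of_real F y.
Proof. by case: F => //=; exact: (rmorphD (@real_complex_def R (Phant R))). Qed.

Lemma of_realM x y : of_real F (x * y) = of_real F x * of_real F y.
Proof. by case: F => //=; exact: (rmorphM (@real_complex_def R (Phant R))). Qed.

Lemma of_real_inj : injective (@of_real R F).
Proof. by case: F => //= x y []. Qed.

Lemma real_of_realP w : w \is Num.real -> exists x, w = of_real F x.
Proof.
case: F w => /= w wr; first by exists w.
by exists (complex.Re w); rewrite -[LHS]RRe_real.
Qed.

Lemma modulus_ge0 z : 0 <= modulus z.
Proof. by rewrite -of_real_le of_real_modulus of_real0 normr_ge0. Qed.

Lemma RorC_complete (H : set_system (RorC R F)) :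
  ProperFilter H -> cauchy H -> cvg H.
Proof. by case: F H => /= H; [exact: R_complete|exact: complex_complete]. Qed.

End RorC_theory.

Section BUC_def.
Context {R : realType} (F : field_kind) (g : R -> R) (a b : R).

Definition itvcc := {t : R | t \in `[a, b]}.

(* For F = ComplexField, 0 < e in R[i] means that e is a positive real. *)
Definition uniformly_gcontinuous (f : itvcc -> RorC R F) : Prop :=
  forall e : RorC R F, 0 < e -> exists2 d : R, 0 < d &
    forall t s : itvcc, `|g (val t) - g (val s)| < d -> `|f t - f s| < e.

Definition BUC_pred : {pred itvcc -> RorC R F} :=
  mem [set f | bounded_fun f /\ uniformly_gcontinuous f].

Record BUC := MkBUC {
  BUC_val :> itvcc -> RorC R F;
  BUC_valP : BUC_val \in BUC_pred }.

HB.instance Definition _ := [isSub for BUC_val].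
HB.instance Definition _ := [Choice of BUC by <:].

Definition uniformly_gequicontinuous (S : set BUC) : Prop :=
  forall e : RorC R F, 0 < e -> exists2 d : R, 0 < d &
    forall f : BUC, S f -> forall t s : itvcc,
      `|g (val t) - g (val s)| < d -> `|f t - f s| < e.

Definition BUC_norm (f : BUC) : RorC R F :=
  of_real F (sup (range (fun t => modulus (f t)))).

End BUC_def.

Section BUC_normed.
Context {R : realType} {F : field_kind} {g : R -> R} {a b : R}.
Local Notation K := (RorC R F).
Local Notation T := (BUC F g a b).

Lemma bounded_funP (f : itvcc a b -> K) :
  bounded_fun f <-> exists2 M, 0 <= M & forall t, `|f t| <= M.
Proof.
split=> [/pinfty_ex_gt0[M M0 fM]|[M M0 fM]].
  by exists M; [exact: ltW|move=> t; exact: fM].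
exists M; split; first exact: ger0_real.
by move=> N MN t _ /=; rewrite (le_trans (fM t))// ltW.
Qed.

Lemma BUC_submod_closed : submod_closed (@BUC_pred R F g a b).
Proof.
split.
  rewrite inE /=; split.
    by exists 0; split=> // M M0 t _ /=; rewrite normr0 ltW.
  by move=> e e0; exists 1 => // t s _; rewrite subrr normr0.
move=> k /= u v; rewrite !inE /= => -[bu cu] [bv cv]; split.
  have /bounded_funP[M M0 hM] := bu; have /bounded_funP[N N0 hN] := bv.
  apply/bounded_funP; exists (`|k| * M + N) => [|t].
    by rewrite addr_ge0// mulr_ge0.
  rewrite (le_trans (ler_normD _ _))// lerD ?hN// normrM.
  by rewrite ler_wpM2l// hM.
move=> e e0.
have k1 : 0 < `|k| + 1 by rewrite ltr_wpDl.
have e20 : 0 < e / 2 by rewrite divr_gt0.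
have [d d0 ud] := cu _ (divr_gt0 e20 k1).
have [d' d'0 vd] := cv _ e20.
exists (Num.min d d'); first by rewrite lt_min d0.
move=> t s; rewrite lt_min => /andP[/ud uts /vd vts].
have -> : (k *: u + v) t - (k *: u + v) s = k * (u t - u s) + (v t - v s).
  by rewrite mulrBr addrACA opprD.
rewrite (splitr e) (le_lt_trans (ler_normD _ _))// ler_ltD// normrM.
rewrite (@le_trans _ _ ((`|k| + 1) * `|u t - u s|))//.
  by rewrite ler_wpM2r// lerDl.
by rewrite mulrC -ler_pdivlMr// ltW.
Qed.

HB.instance Definition _ := GRing.isSubmodClosed.Build _ _ (@BUC_pred R F g a b)
  BUC_submod_closed.
HB.instance Definition _ := [SubChoice_isSubLmodule of T by <:].

Lemma BUC_has_ubound (f : T) : has_ubound (range (fun t => modulus (f t))).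
Proof.
have [/bounded_funP[M M0 hM] _] : bounded_fun f /\ uniformly_gcontinuous g f.
  by have := BUC_valP f; rewrite inE.
exists (modulus M) => _ [t _ <-].
rewrite -(of_real_le (F := F)) !of_real_modulus.
by rewrite (le_trans (hM t))// ger0_norm.
Qed.

Lemma BUC_norm_ge (f : T) t : `|f t| <= BUC_norm f.
Proof.
rewrite -of_real_modulus of_real_le; apply: ub_le_sup; last by exists t.
exact: BUC_has_ubound.
Qed.

Lemma BUC_norm_le (f : T) (M : K) :
  0 <= M -> (forall t, `|f t| <= M) -> BUC_norm f <= M.
Proof.
move=> M0 fM; have [r Mr] := real_of_realP (ger0_real M0).
rewrite Mr /BUC_norm of_real_le.
have [/eqP ->|/set0P ne] := boolP (range (fun t => modulus (f t)) == set0).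
  by rewrite sup0 -(of_real_le (F := F)) of_real0 -Mr.
apply: ge_sup => // _ [t _ <-].
by rewrite -(of_real_le (F := F)) of_real_modulus -Mr.
Qed.

Lemma BUC_norm_ge0 (f : T) : 0 <= BUC_norm f.
Proof.
rewrite -of_real0 of_real_le.
have [/eqP ->|/set0P[_ [t _ _]]] :=
    boolP (range (fun t => modulus (f t)) == set0); first by rewrite sup0.
rewrite -(of_real_le (F := F)) of_real0.
exact: le_trans (BUC_norm_ge f t).
Qed.

Lemma BUC_normD (f h : T) : BUC_norm (f + h) <= BUC_norm f + BUC_norm h.
Proof.
apply: BUC_norm_le => [|t]; first by rewrite addr_ge0 ?BUC_norm_ge0.
by rewrite (le_trans (ler_normD _ _))// lerD ?BUC_norm_ge.
Qed.

Lemma BUC_normZ (k : K) (f : T) : BUC_norm (k *: f) = `|k| * BUC_norm f.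
Proof.
have le_normZ l h : BUC_norm (l *: h) <= `|l| * BUC_norm h.
  apply: BUC_norm_le => [|t]; first by rewrite mulr_ge0 ?BUC_norm_ge0.
  by rewrite normrM ler_wpM2l ?BUC_norm_ge.
have [->|k0] := eqVneq k 0.
  apply/eqP; rewrite normr0 mul0r eq_le BUC_norm_ge0 andbT.
  by rewrite (le_trans (le_normZ _ _))// normr0 mul0r.
apply/eqP; rewrite eq_le le_normZ/=.
rewrite -ler_pdivlMl ?normr_gt0// -normfV.
by rewrite (le_trans _ (le_normZ _ _))// scalerA mulVf// scale1r.
Qed.

Lemma BUC_norm0_eq0 (f : T) : BUC_norm f = 0 -> f = 0.
Proof.
move=> f0; apply/val_inj/funext => t; apply/eqP.
by rewrite -normr_le0 -f0 BUC_norm_ge.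
Qed.

HB.instance Definition _ := Lmodule_isNormed.Build K T
  BUC_normD BUC_normZ BUC_norm0_eq0.

Lemma BUC_normE (f : T) :
  `|f| = of_real F (sup (range (fun t => modulus (f t)))).
Proof. by []. Qed.

Lemma BUC_complete (H : set_system T) : ProperFilter H -> cauchy H -> cvg H.
Proof.
move=> FH cH.
have cHE e : 0 < e -> \forall f \near H & h \near H,
    forall t, `|(f : T) t - (h : T) t| < e.
  move=> e0; have /cauchy_ballP /(_ _ e0) := cH.
  apply: filterS => -[f h]; rewrite -ball_normE /= => fh t.
  exact: le_lt_trans (BUC_norm_ge (f - h) t) fh.
pose ev t (f : T) := f t.
have cev t : cvg (ev t @ H).
  apply: RorC_complete; apply/cauchy_ballP => e e0.
  have [[A B] /= [HA HB] AB] := cHE _ e0.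
  exists (ev t @` A, ev t @` B) => /=.
    split; rewrite nbhs_simpl /=.
      by apply: filterS HA => z Az; exists z.
    by apply: filterS HB => z Bz; exists z.
  move=> [_ _] /= [[f Af <-] [h Bh <-]].
  by rewrite -ball_normE; exact: (AB (f, h) (conj Af Bh)).
pose l t := lim (ev t @ H).
have lH e : 0 < e -> \forall f \near H, forall t, `|l t - (f : T) t| < e.
  move=> e0; have e20 : 0 < e / 2 by rewrite divr_gt0.
  near=> f => t.
  have fl : \forall h \near H, `|l t - (h : T) t| < e / 2.
    by have /cvgrPdist_lt := cev t; exact.
  have fh : \forall h \near H, forall t, `|(f : T) t - (h : T) t| < e / 2.
    by near: f; apply: nearP_dep; exact: cHE.
  near H => h.
  have fht : forall u, `|f u - h u| < e / 2 by near: h.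
  rewrite (splitr e) (@le_lt_trans _ _ (`|l t - h t| + `|h t - f t|))//.
    by rewrite ler_distD.
  rewrite ltrD//; first by near: h.
  by rewrite distrC fht.
have lP : l \in @BUC_pred R F g a b.
  rewrite inE; split.
    near H => f; have f1 : forall t, `|l t - f t| < 1 by near: f; exact: lH.
    apply/bounded_funP; exists (1 + `|f|) => [|t]; first by rewrite addr_ge0.
    rewrite -(subrK (f t) (l t)) (le_trans (ler_normD _ _))// lerD//.
      exact: ltW.
    exact: BUC_norm_ge.
  move=> e e0; have e30 : 0 < e / 3 by rewrite divr_gt0.
  near H => f; have fe : forall t, `|l t - f t| < e / 3.
    by near: f; exact: lH.
  have [_ /(_ _ e30)[d d0 fd]] : bounded_fun f /\ uniformly_gcontinuous g f.
    by have := BUC_valP f; rewrite inE.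
  exists d => // t s /fd fts.
  have -> : l t - l s = (l t - f t) + (f t - f s) + (f s - l s).
    by ring.
  have -> : e = e / 3 + e / 3 + e / 3 by field.
  rewrite (le_lt_trans (ler_normD _ _))// ltrD//; last by rewrite distrC.
  by rewrite (le_lt_trans (ler_normD _ _))// ltrD.
apply/cvg_ex; exists (MkBUC lP); apply/cvgrPdist_le => e e0.
have := lH e e0; apply: filterS => f lf.
by apply: BUC_norm_le => [|t]; [exact: ltW|exact: ltW (lf t)].
Unshelve. all: by end_near. Qed.

HB.instance Definition _ := Uniform_isComplete.Build T BUC_complete.

End BUC_normed.

(* Main.v *)
Require Import Defs.
From mathcomp Require Import all_boot all_order all_algebra.
From mathcomp Require Import all_classical all_reals all_analysis.
From mathcomp Require Import complex.

Import Order.TTheory GRing.Theory Num.Theory.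
Import numFieldNormedType.Exports.

Local Open Scope classical_set_scope.
Local Open Scope ring_scope.

(** For sufficiency, let [H] be an ultrafilter containing the closure of [S],
which is still equicontinuous and pointwise bounded. Since [g] is monotone,
[g([a, b])] lies in a bounded interval, so for each [d > 0] finitely many
points [s i] suffice for every [t] to be within [g]-distance [d] of one of
them. The values [f (s i)] stay in a compact subset of the scalars, so they
converge along [H], and by equicontinuity the control at the finitely many
[s i] propagates to the sup norm: [H] is Cauchy, hence converges. *)

Lemma ltr_distD3 {K : numFieldType} {x y z w e : K} :
  `|x - y| < e / 3 -> `|y - z| < e / 3 -> `|z - w| < e / 3 -> `|x - w| < e.
Proof.
move=> xy yz zw.
have -> : x - w = (x - y) + (y - z) + (z - w) by rewrite !addrA !subrK.
have -> : e = e / 3 + e / 3 + e / 3.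
  by rewrite -!mulrDl -mulr2n -mulrSr -(mulr_natr e 3) mulfK.
rewrite (le_lt_trans (ler_normD _ _))// ltrD//.
by rewrite (le_lt_trans (ler_normD _ _))// ltrD.
Qed.

(** Along an ultrafilter cluster points are limits: if the preimage of [B] were not in [H], its
    complement would be, and the neighbourhood [B] of [p] would have to meet the complement of
    [B]. *)
Lemma ultra_near_cluster {T : Type} {U : topologicalType} (H : set_system T)
    (h : T -> U) (p : U) (B : set U) :
  UltraFilter H -> cluster (h @ H) p -> nbhs p B -> H (h @^-1` B).
Proof.
move=> UH clp Bp; have [//|HC] := in_ultra_setVsetC (h @^-1` B) UH.
by have [y []] := clp (~` B) B HC Bp.
Qed.

(** Serves to obtain a compact square in the complex plane as the image of one in [R * R]. The
    modulus is at most the sum of the absolute values of the two parts. *)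
Lemma real_complex_continuous (R : realType) :
  continuous (fun p : R * R => Complex p.1 p.2 : (R[i] : numFieldType)).
Proof.
move=> [x y]; apply/cvgrPdist_lt => e e0.
have [d de] : exists d : R, e = (d%:C)%C.
  by exists (complex.Re e); rewrite RRe_real// gtr0_real.
have d0 : 0 < d by rewrite -ltcR -de.
have d20 : 0 < d / 2 by rewrite divr_gt0.
near=> z.
have zx : `|x - z.1| < d / 2.
  near: z; have /cvgrPdist_lt : z.1 @[z --> (x, y)] --> x by exact: cvg_fst.
  exact.
have zy : `|y - z.2| < d / 2.
  near: z; have /cvgrPdist_lt : z.2 @[z --> (x, y)] --> y by exact: cvg_snd.
  exact.
have -> : Complex x y - Complex z.1 z.2 = Complex (x - z.1) (y - z.2) by [].
rewrite de normc_def ltcR /=.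
have d_ge0 := ltW d0.
rewrite -(ger0_norm d_ge0) -sqrtr_sqr ltr_sqrt ?exprn_gt0//.
rewrite -(real_normK (num_real (x - _))) -(real_normK (num_real (y - _))).
rewrite (@le_lt_trans _ _ ((`|x - z.1| + `|y - z.2|) ^+ 2))//.
  by rewrite sqrrD -addrA lerD2l lerDr mulrn_wge0// mulr_ge0.
by rewrite ltrXn2r// ?nnegrE ?addr_ge0// [ltRHS]splitr ltrD.
Unshelve. all: by end_near. Qed.

Section scalars.
Context {R : realType} {F : field_kind}.

(** Heine-Borel: the set lies in a segment over the reals, and in the image of a compact square over
    the complex numbers. *)
Lemma bounded_precompact_RorC (A : set (RorC R F)) :
  bounded_set A -> precompact A.
Proof.
move=> /pinfty_ex_gt0[M M0 AM].
suff [K cK AK] : exists2 K, compact K & A `<=` K.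
  apply: (precompact_subset AK).
  by apply: compact_precompact => //; exact: norm_hausdorff.
have [r Mr] := real_of_realP (gtr0_real M0).
move: A M M0 AM r Mr; case: F => /= A M M0 AM r Mr.
  exists `[- r, r]%classic; first exact: segment_compact.
  by move=> x /AM /=; rewrite Mr in_itv/= ler_norml.
exists ((fun p : R * R => Complex p.1 p.2) @` (`[- r, r] `*` `[- r, r])).
  apply: continuous_compact; last first.
    by apply: compact_setX; exact: segment_compact.
  by apply: continuous_subspaceT => x; exact: real_complex_continuous.
move=> [x y] /AM /=; rewrite Mr normc_def lecR /= => xyr.
exists (x, y) => //=; rewrite !in_itv/= -!ler_norml.
split; apply: le_trans xyr; rewrite -sqrtr_sqr ler_sqrt ?addr_ge0 ?sqr_ge0//.
  by rewrite lerDl sqr_ge0.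
by rewrite lerDr sqr_ge0.
Qed.

End scalars.

Section BUC_compactness.
Context {R : realType} {F : field_kind} {g : R -> R} {a b : R}.
Local Notation K := (RorC R F).
Local Notation T := (BUC F g a b).

(** Cut the line from [g a] upwards into half-open cells of length [d], the value [g (val t)] being
    in cell [k t]. Monotonicity leaves only the cells below [n], and two values in one cell differ
    by less than [d]. *)
Lemma monotone_gnet (d : R) : a <= b -> {homo g : x y / x <= y} -> 0 < d ->
  exists (n : nat) (s : 'I_n -> itvcc a b),
    forall t : itvcc a b, exists i, `|g (val t) - g (val (s i))| < d.
Proof.
move=> ab gh d0.
have ha : a \in `[a, b] by rewrite in_itv/= lexx.
pose k (t : itvcc a b) := Num.truncn ((g (val t) - g a) / d).
pose n := (Num.truncn ((g b - g a) / d)).+1.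
(* One point per cell; the default [a] is taken only for cells that [g] misses. *)
pose s (i : 'I_n) := xget (exist _ a ha : itvcc a b) [set t | k t = i].
have ga (t : itvcc a b) : 0 <= (g (val t) - g a) / d.
  have := valP t; rewrite in_itv/= => /andP[at_ _].
  by rewrite divr_ge0 ?(ltW d0)// subr_ge0 gh.
have kn t : (k t < n)%N.
  rewrite ltnS le_truncn// ler_pM2r ?invr_gt0// lerD2r gh//.
  by have := valP t; rewrite in_itv/= => /andP[].
exists n, s => t; exists (Ordinal (kn t)).
have : k (s (Ordinal (kn t))) = k t.
  by rewrite /s; case: xgetP => [u _ //|/(_ t)[]].
move: (s _) => u kut.
have /andP[t1 t2] := truncn_itv (ga t).
have /andP[] := truncn_itv (ga u); rewrite -/(k u) kut => u1 u2.
have e : g (val t) - g (val u)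
    = ((g (val t) - g a) / d - (g (val u) - g a) / d) * d.
  by rewrite -mulrBl divfK ?gt_eqF// opprB addrA subrK.
rewrite e normrM (gtr0_norm d0) gtr_pMl// ltr_norml ltrBrDl ltrBlDr.
rewrite ltrBlDr (lt_le_trans u2)/= ?(lt_le_trans t2)//.
  by rewrite -natr1 addrC lerD2l.
by rewrite -natr1 lerD2r.
Qed.

Lemma closure_sup_dist {S : set T} {f : T} {e : K} : closure S f -> 0 < e ->
  exists2 h, S h & forall t, `|f t - h t| < e.
Proof.
move=> Sf e0; have [h [Sh]] := Sf _ (nbhsx_ballx f e e0).
rewrite -ball_normE /= => fh; exists h => // t.
exact: le_lt_trans (BUC_norm_ge (f - h) t) fh.
Qed.

(** The [d] that [S] has for [e / 3] works: replace [f] by a uniformly close [h] in [S] at both [t]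
    and [s]. *)
Lemma uniformly_gequicontinuous_closure (S : set T) :
  uniformly_gequicontinuous S -> uniformly_gequicontinuous (closure S).
Proof.
move=> eqS e e0; have e30 : 0 < e / 3 by rewrite divr_gt0.
have [d d0 Sd] := eqS _ e30; exists d => // f Sf t s ts.
have [h Sh fh] := closure_sup_dist Sf e30.
by apply: ltr_distD3 (fh t) (Sd _ Sh _ _ ts) _; rewrite distrC.
Qed.

Lemma bounded_eval_closure (S : set T) (t : itvcc a b) :
  bounded_set [set (f : T) t | f in S] ->
  bounded_set [set (f : T) t | f in closure S].
Proof.
move=> /pinfty_ex_gt0[M M0 SM]; exists (1 + M).
split=> [|N MN _ [f Sf <-]]; first by rewrite gtr0_real// addr_gt0.
have [h Sh fh] := closure_sup_dist Sf ltr01.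
rewrite /= (le_trans _ (ltW MN))// -(subrK (h t) (f t)).
rewrite (le_trans (ler_normD _ _))// lerD//; first exact/ltW/fh.
by apply: SM; exists h.
Qed.

(** Near each [f] every large [M] is a bound at [t]; the near-covering form of compactness turns
    this into one [M] for all of [closure S]. *)
Lemma precompact_bounded_eval (S : set T) (t : itvcc a b) :
  precompact S -> bounded_set [set (f : T) t | f in S].
Proof.
rewrite precompactE => /compact_near_coveringP cS.
have := cS K (pinfty_nbhs K) (fun M f => `|(f : T) t| <= M) _.
case=> [f _|M0 [M0r MS]]; last first.
  by exists M0; split => // M /MS SM _ [f Sf <-]; exact/SM/subset_closure.
exists (ball f 1, [set M | 1 + `|f t| < M]) => /=.
  split; first exact: nbhsx_ballx.
  by exists (1 + `|f t|); split => //; rewrite ger0_real// addr_ge0.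
move=> [h M] [/= fh /ltW]; apply: le_trans.
rewrite -(subrK (f t) (h t)) (le_trans (ler_normD _ _))// lerD2r.
apply: (le_trans (BUC_norm_ge (h - f) t)).
by move: fh; rewrite -ball_normE /= distrC => /ltW.
Qed.

(** The [d] that a single [f] has for [e / 3] serves for [e] on the ball of radius [e / 3] about
    [f]. By near-covering, every small enough [d] then works on the whole closure. *)
Lemma precompact_gequicontinuous (S : set T) :
  precompact S -> uniformly_gequicontinuous S.
Proof.
rewrite precompactE => /compact_near_coveringP cS e e0.
have e30 : 0 < e / 3 by rewrite divr_gt0.
pose P (d : R) (f : T) := forall t s : itvcc a b,
  `|g (val t) - g (val s)| < d -> `|f t - f s| < e.
have : \forall d \near 0^'+, closure S `<=` P d.
  apply: cS => f _.
  have [_ /(_ _ e30)[d d0 fd]] : bounded_fun f /\ uniformly_gcontinuous g f.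
    by have := BUC_valP f; rewrite inE.
  exists (ball f (e / 3), [set d' | d' < d]) => /=.
    by split; [exact: nbhsx_ballx|exact: nbhs_right_lt].
  move=> [h d'] [/= fh d'd] t s ts.
  have {}fh u : `|f u - h u| < e / 3.
    apply: le_lt_trans (BUC_norm_ge (f - h) u) _.
    by move: fh; rewrite -ball_normE.
  apply: ltr_distD3 _ (fd _ _ (lt_trans ts d'd)) (fh s).
  by rewrite distrC.
move=> dS; near (0 : R)^'+ => d; exists d => // f Sf.
by have : closure S `<=` P d; [near: d|apply; exact: subset_closure].
Unshelve. all: by end_near. Qed.

Lemma gequicontinuous_bounded_precompact (S : set T) :
  a <= b -> {homo g : x y / x <= y} ->
  (forall t : itvcc a b, bounded_set [set (f : T) t | f in S]) ->
  uniformly_gequicontinuous S -> precompact S.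
Proof.
move=> ab gh bS /uniformly_gequicontinuous_closure eqS.
rewrite precompactE compact_ultra => H UH HS.
suff cauchyH : cauchy H.
  have cH : H --> lim H by exact: BUC_complete.
  exists (lim H); split => //.
  exact: (closed_cvg (closure S) (@closed_closure _ S) HS _ cH).
(* It suffices that for each [e] some ball of radius [e] belongs to [H]. *)
apply: cauchy_exP => e e0.
(* The errors will add up to three quarters of [e]; the slack is there because strict pointwise
   bounds give only a weak bound on the supremum. *)
have e40 : 0 < e / 4 by rewrite divr_gt0.
have e80 : 0 < e / 4 / 2 by rewrite divr_gt0.
have [d d0 Sd] := eqS _ e40.
have [n [s sn]] := monotone_gnet _ ab gh d0.
have evH (i : 'I_n) : exists l : K,
    \forall f \near H, `|l - (f : T) (s i)| < e / 4 / 2.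
  have [B SB [cB _]] :=
    bounded_precompact_RorC _ (bounded_eval_closure _ _ (bS (s i))).
  pose ev (f : T) := f (s i).
  have evB : H (ev @^-1` B) by apply: filterS HS => f Sf; apply: SB; exists f.
  (* Compactness yields a cluster point of the values at [s i], which is a limit since [H] is an
     ultrafilter. *)
  have [l [_ cl]] := cB (ev @ H) _ evB.
  have evl := ultra_near_cluster _ _ _ _ UH cl (nbhsx_ballx l _ e80).
  by exists l; rewrite -ball_normE in evl.
have [l lH] := choice evH.
have near_l : \forall f \near H, closure S f /\
    forall i, `|l i - (f : T) (s i)| < e / 4 / 2.
  by apply: filterI => //; exact: filter_forall.
have [f [Sf fl]] := filter_ex near_l.
exists f; apply: filterS near_l => h [Sh hl]; rewrite -ball_normE /=.
have fh t : `|f t - h t| <= e / 4 + e / 4 + e / 4.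
  have [i /[dup] tsi] := sn t; rewrite distrC => sit.
  (* Going through [s i] and [l i] costs [e / 4], [e / 8], [e / 8] and [e / 4]. *)
  have -> : f t - h t = (f t - f (s i)) + ((f (s i) - l i) + (l i - h (s i)))
      + (h (s i) - h t).
    by rewrite !addrA !subrK.
  apply: (le_trans (ler_normD _ _)); apply: lerD; last exact/ltW/Sd.
  apply: (le_trans (ler_normD _ _)); apply: lerD; first exact/ltW/Sd.
  apply: (le_trans (ler_normD _ _)); rewrite [leRHS]splitr.
  by apply: lerD; apply: ltW; rewrite // distrC.
apply: (@le_lt_trans _ _ (e / 4 + e / 4 + e / 4)).
  by apply: BUC_norm_le => //; rewrite !addr_ge0 ?ltW.
by rewrite -!mulrDl ltr_pdivrMr// -mulr2n -mulrSr mulr_natr ltr_pMn2l.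
Qed.

End BUC_compactness.

Theorem theorem3p12 (R : realType) (F : field_kind) (a b : R) (g : R -> R)
  (ab : a < b)
  (g_nondecreasing : {homo g : x y / x <= y})
  (g_left_continuous : forall t : R, g s @[s --> t^'-] --> g t)
  (S : set (BUC F g a b)) :
  precompact S <->
  (forall t : itvcc a b, bounded_set [set (f : BUC F g a b) t | f in S]) /\
  uniformly_gequicontinuous S.
Proof.
split=> [pS|[]].
  split=> [t|]; first exact: precompact_bounded_eval.
  exact: precompact_gequicontinuous.
exact/gequicontinuous_bounded_precompact/g_nondecreasing/ltW.
Qed.
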